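(* Let $\mathcal{D}$ be a triangulated category and $(\mathcal{D}^{\leq 0},\mathcal{D}^{\geq 1})$ a bounded $t$-structure on $\mathcal{D}$ whose heart $\mathcal{H}$ is contravariantly finite in $\mathcal{D}$. Let $\mathcal{C}=\{\mathcal{C}(k)\}_{k\in\mathbb{Z}}$ be a contravariantly finite ICE sequence in $\mathcal{H}$ which terminates to zero. Then $$\mathcal{U}=\theta(\mathcal{C})=\{X\in\mathcal{D}\mid H^kX\in\mathcal{C}(k)\text{ for all }k\in\mathbb{Z}\}$$ is contravariantly finite in $\mathcal{D}$. Hence $\mathcal{U}$ is an aisle in $\mathcal{D}$.
   Context: All subcategories are full, additive and closed under isomorphisms. For a $t$-structure $(\mathcal{D}^{\leq 0},\mathcal{D}^{\geq 1})$ put $\mathcal{D}^{\leq n}=\mathcal{D}^{\leq 0}[-n]$, $\mathcal{D}^{\geq n+1}=\mathcal{D}^{\geq 1}[-n]$; the heart is the abelian category $\mathcal{H}=\mathcal{D}^{\leq 0}\cap\mathcal{D}^{\geq 0}$, $H^0\colon\mathcal{D}\to\mathcal{H}$ is the associated cohomological functor, $H^kX=H^0(X[k])$. It is bounded if $\bigcup_{n}\mathcal{D}^{\leq n}=\mathcal{D}=\bigcup_{n}\mathcal{D}^{\geq n}$. An aisle in $\mathcal{D}$ is the first component $\mathcal{U}$ of some $t$-structure $(\mathcal{U},\mathcal{V})$ on $\mathcal{D}$. A subcategory $\mathcal{B}$ of $\mathcal{C}$ is contravariantly finite in $\mathcal{C}$ if for every $X\in\mathcal{C}$ there is a morphism $f\colon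 B\to X$ with $B\in\mathcal{B}$ through which every morphism $B'\to X$ with $B'\in\mathcal{B}$ factors. ICE sequences: let $\mathcal{A}$ be an abelian category. A subcategory $\mathcal{C}$ of $\mathcal{A}$ is ICE-closed if it is closed under extensions and, for every morphism $f$ between objects of $\mathcal{C}$, the image and cokernel of $f$ in $\mathcal{A}$ belong to $\mathcal{C}$. For $\mathcal{C}$ ICE-closed, put $\alpha\mathcal{C}=\{A\in\mathcal{C}\mid \ker f\in\mathcal{C}\text{ for every morphism } f\colon C\to A\text{ with }C\in\mathcal{C}\}$; this is a wide subcategory of $\mathcal{A}$ (closed under extensions, kernels and cokernels), hence itself an abelian category. A torsion class in an abelian category is a subcategory closed under extensions and quotients in that category. A sequence $\{\mathcal{C}(k)\}_{k\in\mathbb{Z}}$ of subcategories of $\mathcal{A}$ is an ICE sequence if for every $k$, $\mathcal{C}(k)$ is an ICE-closed subcategory of $\mathcal{A}$ and $\mathcal{C}(k+1)$ is a torsion class in $\alpha(\mathcal{C}(k))$. It is contravariantly finite if each $\mathcal{C}(k)$ is contravariantly finite in $\mathcal{A}$; it terminates to zero if $\mathcal{C}(n)=0$ for some integer $n$. *)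

(* Defs.v *)
From mathcomp Require Import all_boot all_order all_algebra.
From mathcomp Require Import boolp.
Set Implicit Arguments.
Unset Strict Implicit.
Unset Printing Implicit Defensive.
Import GRing.Theory.
Local Open Scope ring_scope.

(** * Preadditive and additive categories *)

Record preadditive := Preadditive {
  obj :> Type;
  hom : obj -> obj -> zmodType;
  idm : forall X, hom X X;
  comp : forall X Y Z, hom Y Z -> hom X Y -> hom X Z;
  compA : forall X Y Z T (h : hom Z T) (g : hom Y Z) (f : hom X Y),
    comp h (comp g f) = comp (comp h g) f;
  comp1m : forall X Y (f : hom X Y), comp (idm Y) f = f;
  compm1 : forall X Y (f : hom X Y), comp f (idm X) = f;
  compDl : forall X Y Z (g g' : hom Y Z) (f : hom X Y),
    comp (g + g') f = comp g f + comp g' f;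
  compDr : forall X Y Z (g : hom Y Z) (f f' : hom X Y),
    comp g (f + f') = comp g f + comp g f' }.

Arguments hom {p} X Y.
Arguments idm {p} X.
Arguments comp {p X Y Z} g f.

(* [g \oc f] is "g after f". *)
Notation "g \oc f" := (comp g f) (at level 40, left associativity).

Definition is_iso (A : preadditive) (X Y : A) (f : hom X Y) : Prop :=
  exists g : hom Y X, g \oc f = idm X /\ f \oc g = idm Y.

Definition isomorphic (A : preadditive) (X Y : A) : Prop :=
  exists f : hom X Y, is_iso f.

Definition epi (A : preadditive) (X Y : A) (f : hom X Y) : Prop :=
  forall (Z : A) (g h : hom Y Z), g \oc f = h \oc f -> g = h.

Definition is_zero (A : preadditive) (X : A) : Prop :=
  forall Y : A, (forall f : hom X Y, f = 0) /\ (forall f : hom Y X, f = 0).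

Definition is_direct_sum (A : preadditive) (X Y S : A) : Prop :=
  exists (i1 : hom X S) (i2 : hom Y S) (p1 : hom S X) (p2 : hom S Y),
    [/\ p1 \oc i1 = idm X, p2 \oc i2 = idm Y, p1 \oc i2 = 0, p2 \oc i1 = 0
      & i1 \oc p1 + i2 \oc p2 = idm S].

Definition is_additive (A : preadditive) : Prop :=
  (exists Z : A, is_zero Z) /\
  (forall X Y : A, exists S : A, is_direct_sum X Y S).

(** * Kernels, cokernels, images, short exact sequences *)

Definition is_kernel (A : preadditive) (X Y : A) (f : hom X Y)
    (K : A) (k : hom K X) : Prop :=
  f \oc k = 0 /\
  forall (T : A) (x : hom T X), f \oc x = 0 ->
    exists! y : hom T K, k \oc y = x.

Definition is_cokernel (A : preadditive) (X Y : A) (f : hom X Y)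
    (Q : A) (q : hom Y Q) : Prop :=
  q \oc f = 0 /\
  forall (T : A) (x : hom Y T), x \oc f = 0 ->
    exists! y : hom Q T, y \oc q = x.

(* The image is the kernel of the cokernel. *)
Definition is_image (A : preadditive) (X Y : A) (f : hom X Y)
    (I : A) (m : hom I Y) : Prop :=
  exists (Q : A) (q : hom Y Q), is_cokernel f q /\ is_kernel q m.

Definition short_exact (A : preadditive) (X Y Z : A)
    (f : hom X Y) (g : hom Y Z) : Prop :=
  is_kernel g f /\ is_cokernel f g.

(** * Subcategories *)

(* A full subcategory is given by its objects. *)
Definition subcat (A : preadditive) := A -> Prop.

Definition additive_subcat (A : preadditive) (P : subcat A) : Prop :=
  [/\ forall X Y : A, isomorphic X Y -> P X -> P Y,
      exists Z : A, is_zero Z /\ P Z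
    & forall X Y S : A, is_direct_sum X Y S -> P X -> P Y -> P S].

Definition full_subcat (A : preadditive) (P : subcat A) : preadditive :=
  @Preadditive {X : A | P X} (fun X Y => hom (sval X) (sval Y))
    (fun X => idm (sval X)) (fun X Y Z g f => g \oc f)
    (fun X Y Z T h g f => compA h g f)
    (fun X Y f => comp1m f) (fun X Y f => compm1 f)
    (fun X Y Z g g' f => compDl g g' f) (fun X Y Z g f f' => compDr g f f').

Definition contravariantly_finite (A : preadditive) (P : subcat A) : Prop :=
  forall X : A, exists (B : A) (f : hom B X), P B /\
    forall (B' : A) (g : hom B' X), P B' -> exists h : hom B' B, g = f \oc h.

(* The notions below are meant for abelian categories (such as the heart of a
   t-structure), where kernels, cokernels and images exist and are unique up to
   isomorphism; "the kernel of f lies in P" is stated for every kernel of f. *)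

Definition extension_closed (A : preadditive) (P : subcat A) : Prop :=
  forall (X Y Z : A) (f : hom X Y) (g : hom Y Z),
    short_exact f g -> P X -> P Z -> P Y.

Definition torsion_class (A : preadditive) (T : subcat A) : Prop :=
  [/\ additive_subcat T, extension_closed T
    & forall (X Y : A) (p : hom X Y), epi p -> T X -> T Y].

Definition ICE_closed (A : preadditive) (C : subcat A) : Prop :=
  [/\ additive_subcat C, extension_closed C,
      forall (X Y : A) (f : hom X Y), C X -> C Y ->
        forall (I : A) (m : hom I Y), is_image f m -> C I
    & forall (X Y : A) (f : hom X Y), C X -> C Y ->
        forall (Q : A) (q : hom Y Q), is_cokernel f q -> C Q].

Definition alpha (A : preadditive) (C : subcat A) : subcat A := fun X =>
  C X /\
  forall (Y : A) (f : hom Y X), C Y ->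
    forall (K : A) (k : hom K Y), is_kernel f k -> C K.

Definition ICE_sequence (A : preadditive) (C : int -> subcat A) : Prop :=
  forall k : int,
    [/\ ICE_closed (C k),
        forall X : A, C (k + 1) X -> alpha (C k) X
      & torsion_class (fun X : full_subcat (alpha (C k)) => C (k + 1) (sval X))].

Definition terminates_to_zero (A : preadditive) (C : int -> subcat A) : Prop :=
  exists n : int, forall X : A, C n X -> is_zero X.

(** * Triangulated categories *)

Record additive_functor (A B : preadditive) := AdditiveFunctor {
  fobj :> A -> B;
  fmap : forall X Y : A, hom X Y -> hom (fobj X) (fobj Y);
  fmap1 : forall X : A, fmap (idm X) = idm (fobj X);
  fmapM : forall (X Y Z : A) (g : hom Y Z) (f : hom X Y),
    fmap (g \oc f) = fmap g \oc fmap f;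
  fmapD : forall (X Y : A) (f g : hom X Y), fmap (f + g) = fmap f + fmap g }.

Arguments fmap {A B} a {X Y} f.

Definition functor_id (A : preadditive) : additive_functor A A :=
  @AdditiveFunctor A A id (fun X Y f => f)
    (fun _ => erefl) (fun _ _ _ _ _ => erefl) (fun _ _ _ _ => erefl).

Definition functor_comp (A B C : preadditive)
    (G : additive_functor B C) (F : additive_functor A B) :
  additive_functor A C.
Proof.
refine (@AdditiveFunctor A C (fun X => G (F X))
          (fun X Y f => fmap G (fmap F f)) _ _ _).
- by move=> X; rewrite !fmap1.
- by move=> X Y Z g f; rewrite !fmapM.
- by move=> X Y f g; rewrite !fmapD.
Defined.

Definition nat_isomorphic (A B : preadditive) (F G : additive_functor A B) :
    Prop :=
  exists eta : forall X : A, hom (F X) (G X),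
    (forall X, is_iso (eta X)) /\
    (forall X Y (f : hom X Y), eta Y \oc fmap F f = fmap G f \oc eta X).

(* The shift is an autoequivalence with a chosen quasi-inverse; strict
   automorphisms are a special case. *)
Record triangulated := Triangulated {
  tcat :> preadditive;
  tcat_additive : is_additive tcat;
  shift1 : additive_functor tcat tcat;
  shiftN1 : additive_functor tcat tcat;
  shift1K : nat_isomorphic (functor_comp shiftN1 shift1) (functor_id tcat);
  shiftN1K : nat_isomorphic (functor_comp shift1 shiftN1) (functor_id tcat);
  (* [dist f g h]: X -f-> Y -g-> Z -h-> X[1] is distinguished *)
  dist : forall X Y Z : tcat,
    hom X Y -> hom Y Z -> hom Z (shift1 X) -> Prop;
  TR1_iso : forall (X Y Z X' Y' Z' : tcat)
    (f : hom X Y) (g : hom Y Z) (h : hom Z (shift1 X))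
    (f' : hom X' Y') (g' : hom Y' Z') (h' : hom Z' (shift1 X'))
    (a : hom X X') (b : hom Y Y') (c : hom Z Z'),
    is_iso a -> is_iso b -> is_iso c ->
    b \oc f = f' \oc a -> c \oc g = g' \oc b -> fmap shift1 a \oc h = h' \oc c ->
    dist f g h -> dist f' g' h';
  TR1_id : forall X Z : tcat, is_zero Z ->
    dist (idm X) (0 : hom X Z) (0 : hom Z (shift1 X));
  TR1_cone : forall (X Y : tcat) (f : hom X Y),
    exists (Z : tcat) (g : hom Y Z) (h : hom Z (shift1 X)), dist f g h;
  TR2 : forall (X Y Z : tcat)
    (f : hom X Y) (g : hom Y Z) (h : hom Z (shift1 X)),
    dist f g h <-> dist g h (- fmap shift1 f);
  TR3 : forall (X Y Z X' Y' Z' : tcat)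
    (f : hom X Y) (g : hom Y Z) (h : hom Z (shift1 X))
    (f' : hom X' Y') (g' : hom Y' Z') (h' : hom Z' (shift1 X'))
    (a : hom X X') (b : hom Y Y'),
    dist f g h -> dist f' g' h' -> b \oc f = f' \oc a ->
    exists c : hom Z Z', c \oc g = g' \oc b /\ fmap shift1 a \oc h = h' \oc c;
  (* the octahedral axiom *)
  TR4 : forall (X Y Z X' Y' Z' : tcat)
    (f : hom X Y) (a : hom Y Z') (a' : hom Z' (shift1 X))
    (g : hom Y Z) (b : hom Z X') (b' : hom X' (shift1 Y))
    (c : hom Z Y') (c' : hom Y' (shift1 X)),
    dist f a a' -> dist g b b' -> dist (g \oc f) c c' ->
    exists (u : hom Z' Y') (v : hom Y' X'),
      [/\ dist u v (fmap shift1 a \oc b'),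
          u \oc a = c \oc g, c' \oc u = a',
          v \oc c = b & b' \oc v = fmap shift1 f \oc c'] }.

Arguments dist {t X Y Z} f g h.
Arguments shift1 {t}.
Arguments shiftN1 {t}.

(* X[n] *)
Definition shift (D : triangulated) (n : int) (X : D) : D :=
  match n with
  | Posz m => iter m shift1 X
  | Negz m => iter m.+1 shiftN1 X
  end.

(* The strict full subcategory P[n]. *)
Definition shift_subcat (D : triangulated) (P : subcat D) (n : int) : subcat D :=
  fun X => exists Y : D, P Y /\ isomorphic X (shift n Y).

(** * t-structures *)

Definition is_t_structure (D : triangulated) (U V : subcat D) : Prop :=
  [/\ additive_subcat U /\ additive_subcat V,
      forall X : D, U X -> U (shift1 X),
      forall X : D, V X -> V (shiftN1 X),
      forall (X Y : D) (f : hom X Y), U X -> V Y -> f = 0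
    & forall X : D, exists AB : D * D,
        [/\ U AB.1, V AB.2
          & exists (f : hom AB.1 X) (g : hom X AB.2) (h : hom AB.2 (shift1 AB.1)),
              dist f g h]].

Definition aisle (D : triangulated) (U : subcat D) : Prop :=
  exists V : subcat D, is_t_structure U V.

Record t_structure (D : triangulated) := TStructure {
  t_le0 : subcat D;
  t_ge1 : subcat D;
  t_structureP : is_t_structure t_le0 t_ge1 }.

Definition t_le (D : triangulated) (t : t_structure D) (n : int) : subcat D :=
  shift_subcat (t_le0 t) (- n).

Definition t_ge (D : triangulated) (t : t_structure D) (n : int) : subcat D :=
  shift_subcat (t_ge1 t) (- (n - 1)).

Definition bounded (D : triangulated) (t : t_structure D) : Prop :=
  (forall X : D, exists n : int, t_le t n X) /\
  (forall X : D, exists n : int, t_ge t n X).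

Definition in_heart (D : triangulated) (t : t_structure D) : subcat D :=
  fun X => t_le t 0 X /\ t_ge t 0 X.

Definition heart (D : triangulated) (t : t_structure D) : preadditive :=
  full_subcat (in_heart t).

(** * Truncations and the cohomology objects H^k *)

Lemma truncation_ex (D : triangulated) (t : t_structure D) (X : D) :
  exists AB : D * D,
    [/\ t_le0 t AB.1, t_ge1 t AB.2
      & exists (f : hom AB.1 X) (g : hom X AB.2) (h : hom AB.2 (shift1 AB.1)),
          dist f g h].
Proof. by case: (t_structureP t). Qed.

(* The truncations are unique up to (unique) isomorphism; one is chosen. *)
Definition tau_le0 (D : triangulated) (t : t_structure D) (X : D) : D :=
  (sval (cid (truncation_ex t X))).1.

Definition tau_ge1 (D : triangulated) (t : t_structure D) (X : D) : D :=
  (sval (cid (truncation_ex t X))).2.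

Definition tau_ge0 (D : triangulated) (t : t_structure D) (X : D) : D :=
  shift1 (tau_ge1 t (shiftN1 X)).

Lemma comp0m (A : preadditive) (X Y Z : A) (f : hom X Y) :
  (0 : hom Y Z) \oc f = 0.
Proof. by apply: (addrI (0 \oc f)); rewrite -compDl !addr0. Qed.

Lemma compm0 (A : preadditive) (X Y Z : A) (g : hom Y Z) :
  g \oc (0 : hom X Y) = 0.
Proof. by apply: (addrI (g \oc 0)); rewrite -compDr !addr0. Qed.

Lemma compmN (A : preadditive) (X Y Z : A) (g : hom Y Z) (f : hom X Y) :
  g \oc (- f) = - (g \oc f).
Proof. by apply: (addrI (g \oc f)); rewrite -compDr !subrr compm0. Qed.

Lemma compNm (A : preadditive) (X Y Z : A) (g : hom Y Z) (f : hom X Y) :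
  (- g) \oc f = - (g \oc f).
Proof. by apply: (addrI (g \oc f)); rewrite -compDl !subrr comp0m. Qed.

Lemma fmap0 (A B : preadditive) (F : additive_functor A B) (X Y : A) :
  fmap F (0 : hom X Y) = 0.
Proof. by apply: (addrI (fmap F 0)); rewrite -fmapD !addr0. Qed.

Lemma is_zeroP (A : preadditive) (X : A) : idm X = 0 -> is_zero X.
Proof.
move=> X0 Y; split=> f; first by rewrite -[f]compm1 X0 compm0.
by rewrite -[f]comp1m X0 comp0m.
Qed.

Lemma is_zero_shift1 (D : triangulated) (X : D) : is_zero X -> is_zero (shift1 X).
Proof.
by move=> X0; apply: is_zeroP; rewrite -fmap1 (proj1 (X0 X) (idm X)) fmap0.
Qed.

Lemma isomorphic_sym (A : preadditive) (X Y : A) :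
  isomorphic X Y -> isomorphic Y X.
Proof. by case=> f [g [gf fg]]; exists g, f. Qed.

Lemma isomorphic_trans (A : preadditive) (X Y Z : A) :
  isomorphic X Y -> isomorphic Y Z -> isomorphic X Z.
Proof.
case=> f [f' [f'f ff']] [g [g' [g'g gg']]]; exists (g \oc f), (f' \oc g').
split; first by rewrite compA -(compA f' g' g) g'g compm1 f'f.
by rewrite compA -(compA g f f') ff' compm1 gg'.
Qed.

Lemma isomorphic_shift1 (D : triangulated) (X Y : D) :
  isomorphic (shift1 X) (shift1 Y) -> isomorphic X Y.
Proof.
case=> f [g [gf fg]].
have isoK (Z : D) : isomorphic (shiftN1 (shift1 Z)) Z.
  by have [eta [etaP _]] := shift1K D; exists (eta Z); apply: etaP.
apply: isomorphic_trans (isomorphic_sym (isoK X)) _.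
apply: isomorphic_trans _ (isoK Y).
by exists (fmap shiftN1 f), (fmap shiftN1 g); rewrite -!fmapM gf fg !fmap1.
Qed.

Lemma dist_weak_cokernel (D : triangulated) (X Y Z W : D)
    (f : hom X Y) (g : hom Y Z) (h : hom Z (shift1 X)) (x : hom Y W) :
  dist f g h -> x \oc f = 0 -> exists y : hom Z W, y \oc g = x.
Proof.
move=> fgh xf; have [[O O0] _] := tcat_additive D.
have tri : dist (0 : hom O W) (idm W) (0 : hom W (shift1 O)).
  by apply/TR2; rewrite fmap0 oppr0; apply: TR1_id; apply: is_zero_shift1.
have [|y [yg _]] := TR3 (a := 0) (b := x) fgh tri; first by rewrite comp0m.
by exists y; rewrite yg comp1m.
Qed.

Lemma t_le0_cone (D : triangulated) (t : t_structure D) (X Y Z : D)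
    (f : hom X Y) (g : hom Y Z) (h : hom Z (shift1 X)) :
  dist f g h -> t_le0 t Y -> t_le0 t (shift1 X) -> t_le0 t Z.
Proof.
move=> fgh UY UX; have [[[Uiso _ _] _] US _ UV _] := t_structureP t.
have [[A B] /= [UA VB [u [v [w uvw]]]]] := truncation_ex t Z.
have v0 : v = 0.
  have [y <-] := dist_weak_cokernel (proj1 (TR2 f g h) fgh) (UV _ _ (v \oc g) UY VB).
  by rewrite (UV _ _ y UX VB) comp0m.
have vwu := proj1 (TR2 u v w) uvw.
have wuv := proj1 (TR2 v w _) vwu.
have B0 : is_zero B.
  have [|r rw] := dist_weak_cokernel (x := idm B) vwu.
    by rewrite v0 compm0.
  by apply: is_zeroP; rewrite -rw (UV _ _ r (US _ UA) VB) comp0m.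
have [|r] := dist_weak_cokernel (x := idm (shift1 A)) wuv.
  by rewrite (proj1 (B0 _) w) compm0.
rewrite compmN -compNm; set r' := - r => ru.
have [|y] := dist_weak_cokernel (x := fmap shift1 u \oc r' - idm _)
  (proj1 (TR2 _ _ _) wuv).
  by rewrite compDl compmN -compA ru compm1 compNm comp1m opprK addNr.
rewrite (proj1 (is_zero_shift1 B0 _) y) comp0m => /esym/eqP.
rewrite subr_eq0 => /eqP ur.
apply: Uiso UA; apply: isomorphic_shift1.
by exists (fmap shift1 u), r'.
Qed.

Lemma H0_subproof (D : triangulated) (t : t_structure D) (X : D) :
  in_heart t (tau_ge0 t (tau_le0 t X)).
Proof.
have [[[Uiso _ _] _] US _ _ _] := t_structureP t.
have UY : t_le0 t (tau_le0 t X).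
  by rewrite /tau_le0; case: cid => AB [].
rewrite /tau_ge0; move: (tau_le0 t X) UY => Y UY.
rewrite /tau_ge1; case: cid => -[A B] /= [UA VB [f [g [h fgh]]]].
have isorefl Z : isomorphic (A := D) Z Z.
  by exists (idm Z), (idm Z); rewrite comp1m.
split; last first.
  by exists B; split; [|rewrite sub0r opprK; apply: isorefl].
exists (shift1 B); split; last by rewrite oppr0; apply: isorefl.
move: fgh => /TR2/TR2/TR2 /t_le0_cone; apply; last by do 2!apply: (US).
apply: Uiso UY; apply: isomorphic_sym.
by have [eta [etaP _]] := shiftN1K D; exists (eta Y); apply: etaP.
Qed.

Definition H0 (D : triangulated) (t : t_structure D) (X : D) : heart t :=
  exist _ (tau_ge0 t (tau_le0 t X)) (H0_subproof t X).

Definition Hk (D : triangulated) (t : t_structure D) (k : int) (X : D) : heart t :=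
  H0 t (shift k X).

Definition theta (D : triangulated) (t : t_structure D)
    (C : int -> subcat (heart t)) : subcat D :=
  fun X => forall k : int, C k (Hk t k X).

(* Main.v *)
(** The truncation triangle [A -> X -> V] of an object [X] with respect to
    [theta C] is assembled one degree at a time.  Suppose [Hom(C(j)[-j], V) = 0] for all [j <= k].  Then
    [Hom(-[-k-1], V)] restricted to [C(k+1)] is representable: if [C0 -> V[k+1]]
    is a precover by [C(k+1)], with fiber precovered by [C1], the precover
    factors through the cokernel [I] of [C1 -> C0], because the kernel of this
    map lies in [C k].  The cone [V'] of [I[-k-1] -> V] then satisfies
    [Hom(C(j)[-j], V') = 0] for all [j <= k+1]: a map [K -> I[1]] (with [K] in
    [C(k+1)]) or [K -> I] (with [K] in [C k]) killed by the universal map is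
    zero, since the universal map extends to the middle term of the extension,
    respectively descends to the cokernel, both of which belong to [C(k+1)].

    The fiber of [X -> V] grows by [I[-k-1]] at each step, in a truncation
    triangle, so its cohomology can be read off without the long exact
    sequence.  Boundedness makes the process start with [V = X] and stop once
    [C(k+1) = 0]; at that point [Hom(W, V) = 0] for every [W] in [theta C] by
    devissage.  Contravariant finiteness of [theta C] is a consequence of it
    being an aisle, and idempotents never have to be split. *)

From mathcomp Require Import all_boot all_order all_algebra.
From mathcomp Require Import boolp.
From mathcomp Require Import zify.
Require Import Defs.
Set Implicit Arguments.
Unset Strict Implicit.
Unset Printing Implicit Defensive.
Import Order.TTheory GRing.Theory.
Local Open Scope ring_scope.

(** * Vanishing of Hom and the shift as an equivalence *)

Definition vanish (A : preadditive) (X Y : A) : Prop :=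
  forall f : hom X Y, f = 0.

Lemma compBl (A : preadditive) (X Y Z : A) (g h : hom Y Z) (f : hom X Y) :
  (g - h) \oc f = g \oc f - h \oc f.
Proof. by rewrite compDl compNm. Qed.

Lemma compBr (A : preadditive) (X Y Z : A) (g : hom Y Z) (f h : hom X Y) :
  g \oc (f - h) = g \oc f - g \oc h.
Proof. by rewrite compDr compmN. Qed.

Lemma fmapN (A B : preadditive) (F : additive_functor A B) (X Y : A)
  (f : hom X Y) : fmap F (- f) = - fmap F f.
Proof. by apply: (addrI (fmap F f)); rewrite -fmapD !subrr fmap0. Qed.

Lemma fmapB (A B : preadditive) (F : additive_functor A B) (X Y : A)
  (f g : hom X Y) : fmap F (f - g) = fmap F f - fmap F g.
Proof. by rewrite fmapD fmapN. Qed.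

Lemma isomorphic_refl (A : preadditive) (X : A) : isomorphic X X.
Proof. by exists (idm X), (idm X); rewrite comp1m. Qed.

Lemma isomorphic_fmap (A B : preadditive) (F : additive_functor A B) (X Y : A) :
  isomorphic X Y -> isomorphic (F X) (F Y).
Proof.
by case=> f [g [gf fg]]; exists (fmap F f), (fmap F g);
  rewrite -!fmapM gf fg !fmap1.
Qed.

Lemma zero_isomorphic (A : preadditive) (X Y : A) :
  is_zero X -> is_zero Y -> isomorphic X Y.
Proof.
move=> X0 Y0; exists 0, 0; split; rewrite comp0m; apply: esym.
  by apply: (proj1 (X0 _)).
by apply: (proj1 (Y0 _)).
Qed.

Lemma is_zero_fmap (A B : preadditive) (F : additive_functor A B) (X : A) :
  is_zero X -> is_zero (F X).
Proof.
by move=> X0; apply: is_zeroP; rewrite -fmap1 (proj1 (X0 X) (idm X)) fmap0.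
Qed.

Lemma vanish_isol (A : preadditive) (X X' Y : A) :
  isomorphic X X' -> vanish X Y -> vanish X' Y.
Proof.
case=> u [v [_ uv]] XY f.
by rewrite -[f]compm1 -uv compA (XY (f \oc u)) comp0m.
Qed.

Lemma vanish_isor (A : preadditive) (X Y Y' : A) :
  isomorphic Y Y' -> vanish X Y -> vanish X Y'.
Proof.
case=> u [v [_ uv]] XY f.
by rewrite -[f]comp1m -uv -compA (XY (v \oc f)) compm0.
Qed.

Lemma left_inverse_faithful (A B : preadditive) (F : additive_functor A B)
    (G : additive_functor B A) (X Y : A) (f : hom X Y) :
  nat_isomorphic (functor_comp G F) (functor_id A) -> fmap F f = 0 -> f = 0.
Proof.
case=> eta [etaP etaN] Ff; have [e [_ ee]] := etaP X.
have := etaN _ _ f; rewrite /= Ff fmap0 compm0 => fe.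
by rewrite -[f]compm1 -ee compA -fe comp0m.
Qed.

(** The preimage is [fmap G g] conjugated by the isomorphism [eta]. Its image under [F] agrees with
    [g] after applying [G], and [G] is faithful because [F] is a left inverse of it. *)
Lemma quasi_inverse_full (A B : preadditive) (F : additive_functor A B)
    (G : additive_functor B A) (X Y : A) (g : hom (F X) (F Y)) :
  nat_isomorphic (functor_comp G F) (functor_id A) ->
  nat_isomorphic (functor_comp F G) (functor_id B) ->
  exists f : hom X Y, fmap F f = g.
Proof.
case=> eta [etaP etaN] FG; have [e [eK Ke]] := etaP X.
have [d [dK Kd]] := etaP Y.
exists (eta Y \oc fmap G g \oc e); apply/eqP; rewrite -subr_eq0; apply/eqP.
apply: (left_inverse_faithful FG); rewrite fmapB; apply/eqP; rewrite subr_eq0.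
apply/eqP.
have := etaN _ _ (eta Y \oc fmap G g \oc e) => /= /(congr1 (comp d)).
by rewrite !compA dK !comp1m -[X in _ = X]compA eK compm1.
Qed.

Lemma shift_faithful (D : triangulated) (X Y : D) (f : hom X Y) :
  fmap shift1 f = 0 -> f = 0.
Proof. exact: left_inverse_faithful (shift1K D). Qed.

Lemma shift_full (D : triangulated) (X Y : D) (g : hom (shift1 X) (shift1 Y)) :
  exists f : hom X Y, fmap shift1 f = g.
Proof. exact: quasi_inverse_full (shift1K D) (shiftN1K D). Qed.

Lemma shift1K_iso (D : triangulated) (X : D) :
  isomorphic (shiftN1 (shift1 X)) X.
Proof. by have [eta [etaP _]] := shift1K D; exists (eta X); apply: etaP. Qed.

Lemma shiftN1K_iso (D : triangulated) (X : D) :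
  isomorphic (shift1 (shiftN1 X)) X.
Proof. by have [eta [etaP _]] := shiftN1K D; exists (eta X); apply: etaP. Qed.

Lemma vanish_shift1 (D : triangulated) (X Y : D) :
  vanish (shift1 X) (shift1 Y) <-> vanish X Y.
Proof.
split=> XY f; first by apply: shift_faithful; apply: XY.
by have [g <-] := shift_full f; rewrite (XY g) fmap0.
Qed.

Lemma vanish_shiftN1 (D : triangulated) (X Y : D) :
  vanish (shift1 X) Y <-> vanish X (shiftN1 Y).
Proof.
split=> XY.
  by apply/vanish_shift1; apply: vanish_isor XY; apply/isomorphic_sym/shiftN1K_iso.
by move/vanish_shift1: XY; apply: vanish_isor; apply: shiftN1K_iso.
Qed.

(** * Exactness properties of distinguished triangles *)

Lemma dist_rot (D : triangulated) (X Y Z : D)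
    (f : hom X Y) (g : hom Y Z) (h : hom Z (shift1 X)) :
  dist f g h -> dist g h (- fmap shift1 f).
Proof. by move/TR2. Qed.

(** TR3, applied to the triangle on [idm X] with components [idm X] and [f], factors [g \oc f]
    through a zero map. *)
Lemma dist_comp (D : triangulated) (X Y Z : D)
    (f : hom X Y) (g : hom Y Z) (h : hom Z (shift1 X)) :
  dist f g h -> g \oc f = 0.
Proof.
move=> fgh; have [[O O0] _] := tcat_additive D.
have [|c [_]] := TR3 (a := idm X) (b := f) (TR1_id X O0) fgh; first by [].
move=> _; have [|c' [+ _]] := TR3 (a := idm X) (b := f) (TR1_id X O0) fgh.
  by [].
by rewrite compm0 => ->.
Qed.

Lemma dist_comp23 (D : triangulated) (X Y Z : D)
    (f : hom X Y) (g : hom Y Z) (h : hom Z (shift1 X)) :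
  dist f g h -> h \oc g = 0.
Proof. by move/dist_rot/dist_comp. Qed.

Lemma dist_comp31 (D : triangulated) (X Y Z : D)
    (f : hom X Y) (g : hom Y Z) (h : hom Z (shift1 X)) :
  dist f g h -> fmap shift1 f \oc h = 0.
Proof.
move/dist_rot/dist_rot/dist_comp; rewrite compNm => /eqP.
by rewrite oppr_eq0 => /eqP.
Qed.

(** Comparing with the rotated triangle on [idm T] yields the lift only after a shift, as a map from
    [shift1 T] to [shift1 X]. Fullness of the shift brings it down and faithfulness gives the
    equation. *)
Lemma dist_lift1 (D : triangulated) (X Y Z T : D)
    (f : hom X Y) (g : hom Y Z) (h : hom Z (shift1 X)) (x : hom T Y) :
  dist f g h -> g \oc x = 0 -> exists y : hom T X, x = f \oc y.
Proof.
move=> fgh gx; have [[O O0] _] := tcat_additive D.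
have tri := dist_rot (TR1_id T O0).
have [|c [_]] := TR3 (a := x) (b := 0) tri (dist_rot fgh).
  by rewrite comp0m gx.
have [y <-] := shift_full c; rewrite fmap1 compmN compm1 compNm.
move/oppr_inj; rewrite -fmapM => /eqP; rewrite -subr_eq0 -fmapB => /eqP.
by move/shift_faithful/eqP; rewrite subr_eq0 => /eqP xy; exists y.
Qed.

Lemma dist_lift2 (D : triangulated) (X Y Z T : D)
    (f : hom X Y) (g : hom Y Z) (h : hom Z (shift1 X)) (x : hom T Z) :
  dist f g h -> h \oc x = 0 -> exists y : hom T Y, x = g \oc y.
Proof. by move/dist_rot/dist_lift1; apply. Qed.

Lemma dist_lift3 (D : triangulated) (X Y Z T : D)
    (f : hom X Y) (g : hom Y Z) (h : hom Z (shift1 X)) (x : hom T (shift1 X)) :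
  dist f g h -> fmap shift1 f \oc x = 0 -> exists y : hom T Z, x = h \oc y.
Proof.
move/dist_rot/dist_rot/dist_lift1 => H fx.
by apply: H; rewrite compNm fx oppr0.
Qed.

Lemma dist_desc1 (D : triangulated) (X Y Z W : D)
    (f : hom X Y) (g : hom Y Z) (h : hom Z (shift1 X)) (x : hom Y W) :
  dist f g h -> x \oc f = 0 -> exists y : hom Z W, x = y \oc g.
Proof. by move=> fgh /(dist_weak_cokernel fgh) [y]; exists y. Qed.

Lemma dist_desc2 (D : triangulated) (X Y Z W : D)
    (f : hom X Y) (g : hom Y Z) (h : hom Z (shift1 X)) (x : hom Z W) :
  dist f g h -> x \oc g = 0 -> exists y : hom (shift1 X) W, x = y \oc h.
Proof. by move/dist_rot/dist_desc1; apply. Qed.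

Lemma dist_desc3 (D : triangulated) (X Y Z W : D)
    (f : hom X Y) (g : hom Y Z) (h : hom Z (shift1 X)) (x : hom X W) :
  dist f g h -> fmap shift1 x \oc h = 0 -> exists y : hom Y W, x = y \oc f.
Proof.
move=> /dist_rot/dist_rot tri xh.
have [z xz] := dist_desc1 tri xh.
have [y yz] := shift_full (- z).
exists y; apply/eqP; rewrite -subr_eq0; apply/eqP/shift_faithful.
by rewrite fmapB fmapM yz xz compmN compNm subrr.
Qed.

(** TR1 supplies cones only. The fiber is the desuspended cone, with the maps transported along the
    isomorphism of [shift1 (shiftN1 C)] with [C]. *)
Lemma dist_fiber (D : triangulated) (Y Z : D) (g : hom Y Z) :
  exists (X : D) (f : hom X Y) (h : hom Z (shift1 X)), dist f g h.
Proof.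
have [C [h [k ghk]]] := TR1_cone g.
have [e [d [de ed]]] := shiftN1K_iso C.
have [f fE] := shift_full (- (k \oc e)).
exists (shiftN1 C), f, (d \oc h); apply/TR2; rewrite fE opprK.
apply: (TR1_iso (a := idm Y) (b := idm Z) (c := d)) ghk.
- by exists (idm Y); rewrite comp1m.
- by exists (idm Z); rewrite comp1m.
- by exists e.
- by rewrite comp1m compm1.
- by rewrite compm1.
- by rewrite fmap1 comp1m -compA ed compm1.
Qed.

Lemma dist_extension (D : triangulated) (X Z : D) (h : hom Z (shift1 X)) :
  exists (Y : D) (f : hom X Y) (g : hom Y Z), dist f g h.
Proof.
have [Y [g [k]]] := dist_fiber h.
move=> tri; have [f fE] := shift_full (- k).
by exists Y, f, g; apply/TR2; rewrite fE opprK.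
Qed.

(** Forgetting the maps makes rotation free of signs and lets each term be replaced by an isomorphic
    one, as [shift1] and [shiftN1] are inverse only up to isomorphism. *)
Definition ext (D : triangulated) (X Y Z : D) : Prop :=
  exists (f : hom X Y) (g : hom Y Z) (h : hom Z (shift1 X)), dist f g h.

Lemma ext_iso (D : triangulated) (X Y Z X' Y' Z' : D) :
  isomorphic X X' -> isomorphic Y Y' -> isomorphic Z Z' ->
  ext X Y Z -> ext X' Y' Z'.
Proof.
move=> [a isa] [b isb] [c isc] [f [g [h fgh]]].
case: (isa) (isb) (isc) => a' [a'a aa'] [b' [b'b bb']] [c' [c'c cc']].
exists (b \oc f \oc a'), (c \oc g \oc b'), (fmap shift1 a \oc h \oc c').
apply: (TR1_iso isa isb isc) fgh.
- by rewrite -compA a'a compm1.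
- by rewrite -compA b'b compm1.
- by rewrite -compA c'c compm1.
Qed.

Lemma ext_rot (D : triangulated) (X Y Z : D) : ext X Y Z -> ext Y Z (shift1 X).
Proof. by case=> f [g [h /dist_rot]]; exists g, h, (- fmap shift1 f). Qed.

Lemma ext_rotN (D : triangulated) (X Y Z : D) :
  ext X Y Z -> ext (shiftN1 Z) X Y.
Proof.
case=> f [g [h fgh]].
have [e [d [de ed]]] := shiftN1K_iso Z.
have [u uE] := shift_full (- (h \oc e)).
exists u, f, (d \oc g); apply/TR2; rewrite uE opprK.
apply: (TR1_iso (a := idm X) (b := idm Y) (c := d)) fgh.
- by exists (idm X); rewrite comp1m.
- by exists (idm Y); rewrite comp1m.
- by exists e.
- by rewrite comp1m compm1.
- by rewrite compm1.
- by rewrite fmap1 comp1m -compA ed compm1.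
Qed.

Lemma ext_shift1 (D : triangulated) (X Y Z : D) :
  ext X Y Z -> ext (shift1 X) (shift1 Y) (shift1 Z).
Proof. by move=> H; do 3!apply: ext_rot. Qed.

Lemma ext_shiftN1 (D : triangulated) (X Y Z : D) :
  ext X Y Z -> ext (shiftN1 X) (shiftN1 Y) (shiftN1 Z).
Proof. by move=> H; do 3!apply: ext_rotN. Qed.

Lemma ext_vanishl (D : triangulated) (X Y Z T : D) :
  ext X Y Z -> vanish X T -> vanish Z T -> vanish Y T.
Proof.
case=> f [g [h fgh]] XT ZT x.
by have [y ->] := dist_desc1 fgh (XT (x \oc f)); rewrite (ZT y) comp0m.
Qed.

Lemma ext_vanishr (D : triangulated) (X Y Z T : D) :
  ext X Y Z -> vanish T X -> vanish T Z -> vanish T Y.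
Proof.
case=> f [g [h fgh]] XT ZT x.
by have [y ->] := dist_lift1 fgh (ZT (g \oc x)); rewrite (XT y) compm0.
Qed.

Lemma octahedron_cone (D : triangulated) (X Y Z Z' X' : D) :
  ext X Y Z' -> ext Y Z X' -> exists Y' : D, ext X Z Y' /\ ext Z' Y' X'.
Proof.
case=> f [a [a' faa]] [g [b [b' gbb]]].
have [Y' [c [c' cc]]] := TR1_cone (g \oc f).
have [u [v [uv _ _ _ _]]] := TR4 faa gbb cc.
exists Y'; split; first by exists (g \oc f), c, c'.
by exists u, v, (fmap shift1 a \oc b').
Qed.

(** After rotation this is the octahedron on the composite [X -> V -> V']: its fiber is an extension
    of the fibers [A] and [I] of the two factors. *)
Lemma octahedron_fiber (D : triangulated) (A X V I V' : D) :
  ext A X V -> ext I V V' -> exists A' : D, ext A' X V' /\ ext A A' I.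
Proof.
move=> /ext_rot AXV /ext_rot IVV.
have [Y [XY AY]] := octahedron_cone AXV IVV.
exists (shiftN1 Y); split; first exact: ext_rotN.
by apply: ext_iso (ext_shiftN1 AY);
  [apply: shift1K_iso | apply: isomorphic_refl | apply: shift1K_iso].
Qed.
(** * Truncation triangles and the heart *)

Lemma dist_iso1 (D : triangulated) (X Y Z : D)
    (f : hom X Y) (g : hom Y Z) (h : hom Z (shift1 X)) :
  dist f g h -> is_zero Z -> is_iso f.
Proof.
move=> fgh Z0.
have [|y fy] := dist_lift1 (x := idm Y) fgh; first exact: (proj2 (Z0 _)).
exists y; split=> //; apply/eqP; rewrite -subr_eq0; apply/eqP/shift_faithful.
have [|z ->] := dist_lift3 (x := fmap shift1 (y \oc f - idm X)) fgh.
  by rewrite -fmapM compBr compA -fy comp1m compm1 subrr fmap0.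
by rewrite (proj2 (Z0 _) z) compm0.
Qed.

Lemma ext_zero_iso1 (D : triangulated) (X Y Z : D) :
  ext X Y Z -> is_zero Z -> isomorphic X Y.
Proof. by case=> f [g [h fgh]] /(dist_iso1 fgh); exists f. Qed.

Lemma ext_zero_iso2 (D : triangulated) (X Y Z : D) :
  ext X Y Z -> is_zero X -> isomorphic Y Z.
Proof. by move/ext_rot=> YZ /is_zero_shift1 /(ext_zero_iso1 YZ). Qed.

(** [B] is zero: its identity kills [X -> B], hence factors through [shift1 A], from which every map
    to [B] vanishes. *)
Lemma ext_iso1 (D : triangulated) (A X B : D) :
  ext A X B -> vanish X B -> vanish (shift1 A) B -> isomorphic A X.
Proof.
move=> AXB XB AB; apply: (ext_zero_iso1 AXB); apply: is_zeroP.
case: AXB => f [g [h fgh]].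
have [|y ->] := dist_desc2 (x := idm B) fgh; first exact: XB.
by rewrite (AB y) comp0m.
Qed.

Lemma ext_iso2 (D : triangulated) (A X B : D) :
  ext A X B -> vanish A X -> vanish (shift1 A) B -> isomorphic X B.
Proof.
move=> AXB XB AB; apply: (ext_zero_iso2 AXB); apply: is_zeroP.
case: AXB => f [g [h fgh]]; apply: shift_faithful.
have [|y ->] := dist_lift3 (x := fmap shift1 (idm A)) fgh.
  by rewrite -fmapM (XB (_ \oc _)) fmap0.
by rewrite (AB y) compm0.
Qed.

Lemma dist_lift_unique (D : triangulated) (X Y Z T : D)
    (f : hom X Y) (g : hom Y Z) (h : hom Z (shift1 X)) (x y : hom T X) :
  dist f g h -> vanish (shift1 T) Z -> f \oc x = f \oc y -> x = y.
Proof.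
move=> fgh TZ fxy; apply/eqP; rewrite -subr_eq0; apply/eqP/shift_faithful.
have [|z ->] := dist_lift3 (x := fmap shift1 (x - y)) fgh.
  by rewrite -fmapM compBr fxy subrr fmap0.
by rewrite (TZ z) compm0.
Qed.

Lemma dist_desc_unique (D : triangulated) (X Y Z T : D)
    (f : hom X Y) (g : hom Y Z) (h : hom Z (shift1 X)) (x y : hom Z T) :
  dist f g h -> vanish (shift1 X) T -> x \oc g = y \oc g -> x = y.
Proof.
move=> fgh XT xyg; apply/eqP; rewrite -subr_eq0; apply/eqP.
have [|z ->] := dist_desc2 (x := x - y) fgh.
  by rewrite compBl xyg subrr.
by rewrite (XT z) comp0m.
Qed.

(** The first two vanishing hypotheses produce comparison maps in both directions; the last two make
    factorizations unique, so these maps are mutually inverse. *)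
Lemma ext_unique (D : triangulated) (A X B A' X' B' : D) :
  ext A X B -> ext A' X' B' -> isomorphic X X' ->
  vanish A B' -> vanish A' B -> vanish (shift1 A) B -> vanish (shift1 A') B' ->
  isomorphic A A' /\ isomorphic B B'.
Proof.
move=> AXB AXB' XX' AB' A'B AB A'B'.
have {AXB XX'} := ext_iso (isomorphic_refl A) XX' (isomorphic_refl B) AXB.
case=> f [g [h fgh]]; case: AXB' => f' [g' [h' fgh']].
have [c fc] := dist_lift1 fgh' (AB' (g' \oc f)).
have [c' fc'] := dist_lift1 fgh (A'B (g \oc f')).
have [d gd] := dist_desc1 fgh (AB' (g' \oc f)).
have [d' gd'] := dist_desc1 fgh' (A'B (g \oc f')).
split.
  exists c, c'; split.
    by apply: (dist_lift_unique fgh AB); rewrite compA -fc' -fc compm1.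
  by apply: (dist_lift_unique fgh' A'B'); rewrite compA -fc -fc' compm1.
exists d, d'; split.
  by apply: (dist_desc_unique fgh AB); rewrite -compA -gd -gd' comp1m.
by apply: (dist_desc_unique fgh' A'B'); rewrite -compA -gd' -gd comp1m.
Qed.

(** This is [t_ge t 0] freed from the existential in [shift_subcat]. *)
Definition t_ge0 (D : triangulated) (t : t_structure D) : subcat D :=
  fun X => t_ge1 t (shiftN1 X).

Lemma t_vanish (D : triangulated) (t : t_structure D) (X Y : D) :
  t_le0 t X -> t_ge1 t Y -> vanish X Y.
Proof. by case: (t_structureP t) => _ _ _ H _ XU YV f; apply: H XU YV. Qed.

Lemma t_le0_shift1 (D : triangulated) (t : t_structure D) (X : D) :
  t_le0 t X -> t_le0 t (shift1 X).
Proof. by case: (t_structureP t) => _ H _ _ _; apply: H. Qed.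

Lemma t_ge1_shiftN1 (D : triangulated) (t : t_structure D) (X : D) :
  t_ge1 t X -> t_ge1 t (shiftN1 X).
Proof. by case: (t_structureP t) => _ _ H _ _; apply: H. Qed.

Lemma t_le0_iso (D : triangulated) (t : t_structure D) (X Y : D) :
  isomorphic X Y -> t_le0 t X -> t_le0 t Y.
Proof. by case: (t_structureP t) => -[[H _ _] _] _ _ _ _; apply: H. Qed.

Lemma t_ge1_iso (D : triangulated) (t : t_structure D) (X Y : D) :
  isomorphic X Y -> t_ge1 t X -> t_ge1 t Y.
Proof. by case: (t_structureP t) => -[_ [H _ _]] _ _ _ _; apply: H. Qed.

Lemma truncation (D : triangulated) (t : t_structure D) (X : D) :
  exists A B : D, [/\ t_le0 t A, t_ge1 t B & ext A X B].
Proof. by have [[A B] [? ? ?]] := truncation_ex t X; exists A, B. Qed.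

(** Left orthogonality forces [X] to agree with its truncation. Closure under extensions then
    reduces to vanishing of Hom. *)
Lemma t_le0P (D : triangulated) (t : t_structure D) (X : D) :
  t_le0 t X <-> forall Y : D, t_ge1 t Y -> vanish X Y.
Proof.
split=> [X0 Y|H]; first exact: t_vanish.
have [A [B [A0 B1 AXB]]] := truncation t X.
have AB := t_vanish (t_le0_shift1 A0) B1.
exact: t_le0_iso (ext_iso1 AXB (H _ B1) AB) A0.
Qed.

Lemma t_ge1P (D : triangulated) (t : t_structure D) (Y : D) :
  t_ge1 t Y <-> forall X : D, t_le0 t X -> vanish X Y.
Proof.
split=> [Y1 X X0|H]; first exact: t_vanish X0 Y1.
have [A [B [A0 B1 AXB]]] := truncation t Y.
have AB := t_vanish (t_le0_shift1 A0) B1.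
exact: t_ge1_iso (isomorphic_sym (ext_iso2 AXB (H _ A0) AB)) B1.
Qed.

Lemma t_ge0P (D : triangulated) (t : t_structure D) (Y : D) :
  t_ge0 t Y <-> forall X : D, t_le0 t X -> vanish (shift1 X) Y.
Proof.
split=> [/t_ge1P H X /H /vanish_shiftN1|H] //.
by apply/t_ge1P => X /H /vanish_shiftN1.
Qed.

Lemma t_vanish0 (D : triangulated) (t : t_structure D) (X Y : D) :
  t_le0 t X -> t_ge0 t Y -> vanish (shift1 X) Y.
Proof. by move=> X0 /t_ge0P; apply. Qed.

Lemma t_le0_ext (D : triangulated) (t : t_structure D) (X Y Z : D) :
  ext X Y Z -> t_le0 t X -> t_le0 t Z -> t_le0 t Y.
Proof.
move=> XYZ /t_le0P X0 /t_le0P Z0; apply/t_le0P => B B1.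
by apply: ext_vanishl XYZ _ _; auto.
Qed.

Lemma t_ge1_ext (D : triangulated) (t : t_structure D) (X Y Z : D) :
  ext X Y Z -> t_ge1 t X -> t_ge1 t Z -> t_ge1 t Y.
Proof.
move=> XYZ /t_ge1P X0 /t_ge1P Z0; apply/t_ge1P => B B1.
by apply: ext_vanishr XYZ _ _; auto.
Qed.

Lemma t_ge0_ext (D : triangulated) (t : t_structure D) (X Y Z : D) :
  ext X Y Z -> t_ge0 t X -> t_ge0 t Z -> t_ge0 t Y.
Proof. by move/ext_shiftN1; apply: t_ge1_ext. Qed.

Lemma t_ge1_ge0 (D : triangulated) (t : t_structure D) (X : D) :
  t_ge1 t X -> t_ge0 t X.
Proof. exact: t_ge1_shiftN1. Qed.

Lemma t_ge0_shift1 (D : triangulated) (t : t_structure D) (X : D) :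
  t_ge1 t X -> t_ge0 t (shift1 X).
Proof. by apply: t_ge1_iso; apply/isomorphic_sym/shift1K_iso. Qed.

Lemma t_ge0_iso (D : triangulated) (t : t_structure D) (X Y : D) :
  isomorphic X Y -> t_ge0 t X -> t_ge0 t Y.
Proof. by move=> XY; apply/t_ge1_iso/isomorphic_fmap. Qed.

Lemma t_zero (D : triangulated) (t : t_structure D) (X : D) :
  is_zero X -> t_le0 t X /\ t_ge1 t X.
Proof.
move=> X0; split; first by apply/t_le0P => Y _ f; apply: (proj1 (X0 Y)).
by apply/t_ge1P => Y _ f; apply: (proj2 (X0 Y)).
Qed.

Lemma in_heartP (D : triangulated) (t : t_structure D) (X : D) :
  in_heart t X <-> t_le0 t X /\ t_ge0 t X.
Proof.
split=> [[[Y [Y0]]]|[X0 X1]].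
  rewrite oppr0 => XY [Z [Z1]]; rewrite sub0r opprK => XZ.
  split; first by apply: t_le0_iso Y0; apply: isomorphic_sym.
  by apply: t_ge0_iso (isomorphic_sym XZ) _; apply: t_ge0_shift1.
split; first by exists X; rewrite oppr0; split=> //; apply: isomorphic_refl.
exists (shiftN1 X); rewrite sub0r opprK; split=> //.
by apply/isomorphic_sym/shiftN1K_iso.
Qed.

Lemma heart_le0 (D : triangulated) (t : t_structure D) (X : heart t) :
  t_le0 t (sval X).
Proof. by case: (proj1 (in_heartP t _) (svalP X)). Qed.

Lemma heart_ge0 (D : triangulated) (t : t_structure D) (X : heart t) :
  t_ge0 t (sval X).
Proof. by case: (proj1 (in_heartP t _) (svalP X)). Qed.

(** Factorizations exist in any triangle; they are unique because there are no nonzero maps from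
    [shift1] of a heart object to a heart object. *)
Lemma heart_short_exact (D : triangulated) (t : t_structure D) (X Y Z : heart t)
    (f : hom X Y) (g : hom Y Z) (h : hom (sval Z) (shift1 (sval X))) :
  @dist D (sval X) (sval Y) (sval Z) f g h -> short_exact f g.
Proof.
move=> fgh; split; split; try exact: (dist_comp fgh).
  move=> T x gx; have [y xy] := dist_lift1 fgh gx.
  exists y; split=> // z fz; apply: (dist_lift_unique fgh).
    by apply: t_vanish0 (heart_le0 T) (heart_ge0 Z).
  by rewrite -xy; apply: esym.
move=> T x xf; have [y xy] := dist_desc1 fgh xf.
exists y; split=> // z fz; apply: (dist_desc_unique fgh).
  by apply: t_vanish0 (heart_le0 X) (heart_ge0 T).
by rewrite -xy; apply: esym.
Qed.

(* [K[1] -> cone u -> Q] is a truncation triangle of the cone of [u], and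
   [J] is the image of [u]. *)
Lemma heart_kernel_cokernel (D : triangulated) (t : t_structure D)
    (X Y : heart t) (u : hom X Y) :
  exists (K Q J : heart t) (k : hom K X) (q : hom Y Q) (m : hom J Y),
  [/\ is_kernel u k, is_cokernel u q,
      exists h, @dist D (sval J) (sval Y) (sval Q) m q h
    & forall (Z : D) (f : hom (sval Y) Z), vanish (shift1 (sval K)) Z ->
        @comp D _ _ _ f u = 0 -> exists f', f = @comp D _ _ _ f' q].
Proof.
case: X u => X hX; case: Y => Y hY u.
have /in_heartP [X0 X1] := hX; have /in_heartP [Y0 Y1] := hY.
have [E [v [w uvw]]] := @TR1_cone D X Y u.
(* Truncating [shiftN1 E] and shifting back cuts [E] into its parts in degrees below zero and at
   least zero. *)
have [K [Q [K0 Q1 KEQ]]] : exists K Q : D,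
    [/\ t_le0 t K, t_ge0 t Q & ext (shift1 K) E Q].
  have [K [B [K0 B1 /ext_shift1 KB]]] := truncation t (shiftN1 E).
  exists K, (shift1 B); split=> //; first exact: t_ge0_shift1.
  by apply: ext_iso KB; try exact: isomorphic_refl; apply: shiftN1K_iso.
have YEX : ext Y E (shift1 X) by exists v, w, (- fmap shift1 u); apply: dist_rot.
have E0 : t_le0 t E by apply: t_le0_ext YEX _ _ => //; apply: t_le0_shift1.
have Q0 : t_le0 t Q.
  by apply: t_le0_ext (ext_rot KEQ) _ _ => //; do 2!apply: t_le0_shift1.
(* [shift1 K] is built from [shiftN1 Q] and [E], and [E] from [Y] and [shift1 X]; none of these
   receives a nonzero map from [A] shifted twice. *)
have K1 : t_ge0 t K.
  apply/t_ge0P => A A0; apply/vanish_shift1.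
  apply: ext_vanishr (ext_rotN KEQ) _ _.
    apply: (proj1 (vanish_shiftN1 _ _)).
    exact: t_vanish0 (t_le0_shift1 (t_le0_shift1 A0)) Q1.
  apply: ext_vanishr YEX _ _; first exact: t_vanish0 (t_le0_shift1 A0) Y1.
  by apply/vanish_shift1; apply: t_vanish0 A0 X1.
case: KEQ => a [b [c abc]].
have [k kE] := shift_full (w \oc a).
have [J [m [h mqh]]] := dist_fiber (b \oc v).
(* A map [x] extends from [J] to [Y], where it dies, once [fmap shift1 x \oc h] vanishes.
   Precomposed with [b] and then [v], this obstruction is zero; undoing [v] and [b] leaves factors
   through [shift1 X] and [shift1 (shift1 K)], which map trivially to [shift1 B]. *)
have J0 : t_le0 t J.
  apply/t_le0P => B B1 x.
  have xhq : fmap shift1 x \oc h = 0.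
    have xhq : (fmap shift1 x \oc h \oc b) \oc v = 0.
      by rewrite -!compA (dist_comp23 mqh) compm0.
    have SB1 := t_ge0_shift1 B1.
    have [z] := dist_desc2 uvw xhq; rewrite (t_vanish0 X0 SB1 z) comp0m => xhb.
    have [z' ->] := dist_desc2 abc xhb.
    by rewrite (t_vanish0 (t_le0_shift1 K0) SB1 z') comp0m.
  by have [y ->] := dist_desc3 mqh xhq; rewrite (t_vanish Y0 B1 y) comp0m.
have J1 : t_ge0 t J.
  have JYQ : ext J Y Q by exists m, (b \oc v), h.
  apply/t_ge0P => A A0; apply: ext_vanishr (ext_rotN JYQ) _ (t_vanish0 A0 Y1).
  apply: (proj1 (vanish_shiftN1 _ _)).
  exact: t_vanish0 (t_le0_shift1 A0) Q1.
have hK : in_heart t K by apply/in_heartP.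
have hQ : in_heart t Q by apply/in_heartP.
have hJ : in_heart t J by apply/in_heartP.
(* The descent is proved for targets outside the heart too, since the maps to be descended later end
   in arbitrary objects of [D]. *)
have q_desc (Z : D) (f : hom Y Z) : vanish (shift1 K) Z -> f \oc u = 0 ->
    exists f', f = f' \oc (b \oc v).
  move=> KZ /(dist_desc1 uvw) [y ->].
  by have [z ->] := dist_desc1 abc (KZ (y \oc a)); exists z; rewrite compA.
exists (exist _ K hK), (exist _ Q hQ), (exist _ J hJ), k, (b \oc v), m.
split=> //; last by exists h.
  split=> /=.
    apply: (@shift_faithful D); rewrite fmapM kE compA (dist_comp31 uvw).
    by rewrite comp0m.
  case=> T hT /= x ux; have /in_heartP [T0 T1] := hT.
  have [|y xy] := dist_lift3 (x := fmap shift1 x) uvw.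
    by rewrite -fmapM /= ux fmap0.
  have [z yz] := dist_lift1 abc (t_vanish0 T0 Q1 (b \oc y)).
  have [z' zz'] := shift_full z.
  have k_inj (r s : hom T K) : k \oc r = k \oc s -> r = s.
    move=> krs; have TQ := t_vanish0 (t_le0_shift1 T0) Q1.
    have TY := t_vanish0 T0 Y1.
    apply/eqP; rewrite -subr_eq0; apply/eqP/(@shift_faithful D).
    apply: (dist_lift_unique abc TQ); rewrite compm0.
    have [|p ->] := dist_lift2 (x := a \oc fmap shift1 (r - s)) uvw.
      by rewrite compA -kE -fmapM compBr krs subrr fmap0.
    by rewrite (TY p) compm0.
  have kz : k \oc z' = x.
    apply/eqP; rewrite -subr_eq0; apply/eqP/(@shift_faithful D).
    by rewrite fmapB fmapM kE zz' -compA -yz -xy subrr.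
  by exists z'; split=> // s ks; apply: k_inj; rewrite kz.
split=> /=.
  by rewrite -compA (dist_comp uvw) compm0.
case=> T hT /= x xu; have /in_heartP [T0 T1] := hT.
have [f' xf'] := q_desc _ x (t_vanish0 K0 T1) xu.
exists f'; split=> // s sq.
have KT := t_vanish0 (t_le0_shift1 K0) T1.
apply: (dist_desc_unique abc KT).
apply: (dist_desc_unique uvw (t_vanish0 X0 T1)).
by rewrite -!compA sq.
Qed.
(** * Approximation by a term of an ICE sequence *)

(** [Y'] is the extension classified by [h \oc c]; TR3 on the twice rotated triangles gives the
    shift of [b]. *)
Lemma dist_pullback (D : triangulated) (X Y Z Z' : D)
    (f : hom X Y) (g : hom Y Z) (h : hom Z (shift1 X)) (c : hom Z' Z) :
  dist f g h -> exists (Y' : D) (f' : hom X Y') (g' : hom Y' Z') (b : hom Y' Y),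
    [/\ dist f' g' (h \oc c), b \oc f' = f & g \oc b = c \oc g'].
Proof.
move=> fgh; have [Y' [f' [g' fgh']]] := dist_extension (h \oc c).
have [|d [df dg]] := TR3 (a := c) (b := idm _)
    (dist_rot (dist_rot fgh')) (dist_rot (dist_rot fgh)); first by rewrite comp1m.
have [b bE] := shift_full d; exists Y', f', g', b; split=> //.
  apply/eqP; rewrite -subr_eq0; apply/eqP/(@shift_faithful D).
  apply/eqP; rewrite fmapB fmapM bE subr_eq0 -eqr_opp -compmN df compm1.
  by [].
apply/eqP; rewrite -subr_eq0; apply/eqP/(@shift_faithful D).
apply/eqP; rewrite fmapB !fmapM bE subr_eq0 -eqr_opp -compNm -dg compmN.
by [].
Qed.

Lemma kernel_mono (A : preadditive) (X Y Z T : A)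
    (f : hom X Y) (g : hom Y Z) (x y : hom T X) :
  is_kernel g f -> f \oc x = f \oc y -> x = y.
Proof.
case=> gf ker fxy; have [|z [_ zP]] := ker _ (f \oc x).
  by rewrite compA gf comp0m.
by rewrite -(zP x erefl) (zP y (esym fxy)).
Qed.

Lemma cokernel_epi (A : preadditive) (X Y Z : A)
    (f : hom X Y) (g : hom Y Z) : is_cokernel f g -> epi g.
Proof.
case=> gf coker T x y xy; have [|z [_ zP]] := coker _ (x \oc g).
  by rewrite -compA gf compm0.
by rewrite -(zP x erefl) (zP y (esym xy)).
Qed.

(** Pulling [f : Y -> Q] back along [q] gives [b : E -> I], where [E] is an extension of [Y] by the
    image [J] of [g], hence in [P]. The kernels of [b] and [f] coincide, and that of [b] lies in [P]
    because [I] is in [alpha P]. *)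
Lemma alpha_cokernel (D : triangulated) (t : t_structure D)
    (P : subcat (heart t)) (K I Q J : heart t)
    (g : hom K I) (q : hom I Q) (m : hom J I) h :
  ICE_closed P -> P K -> alpha P I ->
  is_cokernel g q -> @dist D (sval J) (sval I) (sval Q) m q h ->
  alpha P Q.
Proof.
move=> [Padd Pext Pim Pcok] PK [PI ker_I] gq mqh.
split; first exact: Pcok gq.
move=> Y f PY N k [fk ker_k].
have [mker mcok] := heart_short_exact mqh.
have PJ : P J by apply: (Pim _ _ g PK PI J m); exists Q, q.
have [E [i [p [b [ipE bi qb]]]]] := @dist_pullback D _ _ _ _ _ _ _ f mqh.
have hE : in_heart t E.
  have JEY : ext (sval J) E (sval Y) by exists i, p, (h \oc f).
  apply/in_heartP; split; first by apply: t_le0_ext JEY _ _; apply: heart_le0.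
  by apply: t_ge0_ext JEY _ _; apply: heart_ge0.
pose E' : heart t := exist _ E hE.
have [iker pcok] := @heart_short_exact D t J E' Y i p _ ipE.
have PE : P E' by apply: (Pext J E' Y i p).
have fkD : @comp D _ _ _ f k = 0 := fk.
have [|k0 kE] := dist_lift2 (x := k : hom (sval N) (sval Y)) ipE.
  by rewrite -compA fkD compm0.
have [|y yE] := dist_lift1 (x := b \oc k0) mqh.
  by rewrite compA qb -compA -kE fkD.
(* The lift [k0] of [k] along [p] is corrected by a map into [J] so that [b] kills it. *)
pose k' : @hom (heart t) N E' := k0 - i \oc y.
have pk : @comp D _ _ _ p k' = k.
  by rewrite /k' compBr -kE compA (dist_comp ipE) comp0m subr0.
have bk : @comp D _ _ _ b k' = 0.
  by rewrite /k' compBr yE compA bi subrr.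
apply: (ker_I E' b PE N k'); split=> // T x bx.
have bxD : @comp D _ _ _ b x = 0 := bx.
have [|z [kz zP]] := ker_k T (p \oc x).
  change (@comp D _ _ _ f (p \oc x) = 0).
  by rewrite compA -qb -compA bxD compm0.
have kzD : @comp D _ _ _ k z = p \oc x := kz.
exists z; split=> [|z' kz']; last first.
  apply: zP; change (@comp D _ _ _ k z' = p \oc x).
  by rewrite -pk -compA; congr comp.
apply/esym/eqP; rewrite -subr_eq0; apply/eqP.
change (x - @comp D _ _ _ k' z = 0).
have [|w wE] := dist_lift1 (x := x - @comp D _ _ _ k' z) ipE.
  by rewrite compBr [X in _ - X]compA pk kzD subrr.
rewrite wE (_ : w = 0) ?compm0 //.
apply: (@kernel_mono _ _ _ _ _ m q) => //.
change (@comp D _ _ _ m w = @comp D _ _ _ m 0).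
by rewrite compm0 -bi -compA -wE compBr bxD compA bk comp0m subrr.
Qed.

(* The triangle [J -> I -> Q] exhibits the image of [g]. *)
Lemma torsion_cokernel (D : triangulated) (t : t_structure D)
    (P T : subcat (heart t)) (K I Q J : heart t)
    (g : hom K I) (q : hom I Q) (m : hom J I) h :
  ICE_closed P -> (forall X, T X -> alpha P X) ->
  torsion_class (fun X : full_subcat (alpha P) => T (sval X)) ->
  P K -> T I -> is_cokernel g q ->
  @dist D (sval J) (sval I) (sval Q) m q h -> T Q.
Proof.
move=> Pice TP [_ _ Tquot] PK TI gq mqh.
have aQ := alpha_cokernel Pice PK (TP _ TI) gq mqh.
pose I' : full_subcat (alpha P) := exist _ I (TP _ TI).
pose Q' : full_subcat (alpha P) := exist _ Q aQ.
apply: (Tquot I' Q' q) => // Z x y; exact: (cokernel_epi gq).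
Qed.

(** Contravariant finiteness of [T] is available only inside the heart, so [Z] is first precovered
    by a heart object. *)
Lemma heart_precover (D : triangulated) (t : t_structure D)
    (T : subcat (heart t)) (Z : D) :
  contravariantly_finite (in_heart t) -> contravariantly_finite T ->
  exists (C0 : heart t) (f : hom (sval C0) Z), T C0 /\
    forall C : heart t, T C -> forall g : hom (sval C) Z,
      exists r : hom C C0, g = @comp D _ _ _ f r.
Proof.
move=> heart_cf T_cf.
have [X [a [hX aP]]] := heart_cf Z.
have [C0 [b [TC0 bP]]] := T_cf (exist _ X hX).
exists C0, (a \oc b); split=> // C TC g.
have [g' ->] := aP _ g (svalP C).
have [r rE] := bP _ g' TC; exists r.
by rewrite -compA; congr comp.
Qed.

(** The object [I] represents Hom into [Z] on [T]. It is the cokernel of [u : C1 -> C0], and [f]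
    descends to it because the kernel of [u] lies in [P], by the definition of [alpha]. *)
Lemma heart_reflection (D : triangulated) (t : t_structure D)
    (P T : subcat (heart t)) (Z : D) :
  contravariantly_finite (in_heart t) -> contravariantly_finite T ->
  ICE_closed T -> (forall X, T X -> alpha P X) ->
  (forall K, P K -> vanish (shift1 (sval K)) Z) ->
  exists (I : heart t) (phi : hom (sval I) Z), [/\ T I,
    forall C : heart t, T C -> forall g : hom (sval C) Z,
      exists r : hom C I, g = @comp D _ _ _ phi r
    & forall C : heart t, T C -> forall r : hom C I,
      @comp D _ _ _ phi r = 0 -> r = 0].
Proof.
move=> heart_cf T_cf [_ _ _ Tcok] TP PZ.
have [C0 [f [TC0 fP]]] := heart_precover Z heart_cf T_cf.
have [F [a [b abf]]] := dist_fiber f.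
have [C1 [c [TC1 cP]]] := heart_precover F heart_cf T_cf.
pose u : hom C1 C0 := a \oc c.
have fu : f \oc u = 0 by rewrite /u compA (dist_comp abf) comp0m.
have uP (C : heart t) (r : hom C C0) : T C -> f \oc r = 0 ->
    exists r', r = u \oc r'.
  move=> TC /(dist_lift1 abf) [s ->]; have [r' ->] := cP C TC s.
  by exists r'; rewrite compA.
have [K [I [_ [k [q [_ [ku qu _ q_desc]]]]]]] := heart_kernel_cokernel u.
have [_ alC0] := TP _ TC0; have [PC1 _] := TP _ TC1.
have PK : P K by apply: alC0 ku.
have TI : T I by apply: Tcok qu.
have [phi fE] := q_desc _ _ (PZ _ PK) fu.
have [s sE] := fP _ TI phi.
(* [f] kills [s \oc q - idm C0], which therefore factors through [u] and is killed by [q]. Thus [I]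
   is a retract of [C0], which yields injectivity of [phi]. *)
have qs : q \oc s = idm I.
  have [|x xE] := uP _ (s \oc q - idm C0) TC0.
    by rewrite compBr compA -sE -fE compm1 subrr.
  have : q \oc (s \oc q - idm C0) = 0 by rewrite xE compA (proj1 qu) comp0m.
  rewrite compBr compm1 => /eqP; rewrite subr_eq0 => /eqP qsq.
  by apply: (cokernel_epi qu); rewrite comp1m -compA.
exists I, phi; split=> // C TC g.
  have [r ->] := fP _ TC g; exists (q \oc r).
  by rewrite fE -compA.
move=> phig; have [|x xE] := uP _ (s \oc g) TC.
  by rewrite compA -sE.
by rewrite -[g]comp1m -qs -compA xE compA (proj1 qu) comp0m.
Qed.

Lemma approximation_step (D : triangulated) (t : t_structure D)
    (P T : subcat (heart t)) (Z : D) :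
  contravariantly_finite (in_heart t) -> contravariantly_finite T ->
  ICE_closed P -> ICE_closed T -> (forall X, T X -> alpha P X) ->
  torsion_class (fun X : full_subcat (alpha P) => T (sval X)) ->
  (forall K, P K -> vanish (shift1 (sval K)) Z) ->
  exists (I : heart t) (Z' : D), [/\ T I, ext (sval I) Z Z',
    forall K, P K -> vanish (shift1 (sval K)) Z'
    & forall K, T K -> vanish (sval K) Z'].
Proof.
move=> heart_cf T_cf Pice Tice TP Ttors PZ.
have [I [phi [TI phi_ex phi_inj]]] :=
  heart_reflection heart_cf T_cf Tice TP PZ.
have phi_id (r : hom I I) : @comp D _ _ _ phi r = phi -> r = idm I.
  move=> phir; apply/eqP; rewrite -subr_eq0; apply/eqP/phi_inj => //.
  by rewrite compBr phir compm1 subrr.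
have [Z' [psi [d tri]]] := TR1_cone phi.
exists I, Z'; split=> //; first by exists phi, psi, d.
  (* The obstruction to lifting [y] to [Z] is the shift of [g : K -> I]. As [phi] descends to the
     cokernel [Q] of [g], which is in [T], universality makes [q] a split monomorphism and [g]
     zero. *)
  move=> K PK y; have [g gE] := shift_full (d \oc y).
  have phig : phi \oc g = 0.
    by apply: shift_faithful; rewrite fmapM gE compA (dist_comp31 tri) comp0m.
  have [N [Q [J [k [q [m [ku qu [h mqh] q_desc]]]]]]] :=
    @heart_kernel_cokernel D t K I g.
  have PN : P N by have [_ alI] := TP _ TI; apply: alI ku.
  have TQ := torsion_cokernel Pice TP Ttors PK TI qu mqh.
  have [phi' phiE] := q_desc _ _ (PZ _ PN) phig.
  have [r rE] := phi_ex _ TQ phi'.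
  have rq : @comp D _ _ _ r q = idm (sval I)
    by apply: phi_id; rewrite compA -rE.
  have qg : @comp D _ _ _ q g = 0 := proj1 qu.
  have g0 : g = 0 by rewrite -[g]comp1m -rq -compA qg compm0.
  have [|z ->] := dist_lift2 (x := y) tri; first by rewrite -gE g0 fmap0.
  by rewrite (PZ _ PK z) compm0.
(* Here the obstruction [g] is an extension class. Its middle term [E] is in [T] and [phi] extends
   to it, so [i] splits and [g] is zero. *)
move=> K TK y; pose g := d \oc y.
have phig : fmap shift1 phi \oc g = 0 by rewrite compA (dist_comp31 tri) comp0m.
have [E [i [p ipg]]] := dist_extension g.
have hE : in_heart t E.
  have IEK : ext (sval I) E (sval K) by exists i, p, g.
  apply/in_heartP; split; first by apply: t_le0_ext IEK _ _; apply: heart_le0.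
  by apply: t_ge0_ext IEK _ _; apply: heart_ge0.
pose E' : heart t := exist _ E hE.
have TE : T E'.
  case: Tice => _ Text _ _; apply: (Text I E' K i p) => //.
  exact: (@heart_short_exact D t I E' K i p _ ipg).
have [phi' phiE] := dist_desc3 ipg phig.
have [r rE] := phi_ex E' TE phi'.
have ri : @comp D _ _ _ r i = idm (sval I).
  by apply: phi_id; rewrite compA -rE.
have g0 : g = 0.
  rewrite -[g]comp1m -fmap1 -ri fmapM -compA (dist_comp31 ipg).
  by rewrite compm0.
have [z ->] := dist_lift2 tri g0; have [r' ->] := phi_ex K TK z.
by rewrite compA (dist_comp tri) comp0m.
Qed.
(** * Iterated shifts *)

Lemma shift_succ (D : triangulated) (n : int) (X : D) :
  isomorphic (shift (n + 1) X) (shift1 (shift n X)).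
Proof.
case: n => [n|[|n]]; last 2 first.
- exact/isomorphic_sym/shiftN1K_iso.
- have -> : Negz n.+1 + 1 = Negz n by lia.
  exact/isomorphic_sym/shiftN1K_iso.
have -> : Posz n + 1 = Posz n.+1 by lia.
exact: isomorphic_refl.
Qed.

Lemma shift_iso (D : triangulated) (n : int) (X Y : D) :
  isomorphic X Y -> isomorphic (shift n X) (shift n Y).
Proof.
case: n => n XY /=.
  by elim: n => //= n IH; apply: isomorphic_fmap.
by elim: n => /= [|n IH]; apply: isomorphic_fmap.
Qed.

Lemma is_zero_shift (D : triangulated) (n : int) (X : D) :
  is_zero X -> is_zero (shift n X).
Proof.
case: n => n X0 /=.
  by elim: n => //= n IH; apply: is_zero_fmap.
by elim: n => /= [|n IH]; apply: is_zero_fmap.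
Qed.

Lemma shift_add (D : triangulated) (a b : int) (X : D) :
  isomorphic (shift (a + b) X) (shift a (shift b X)).
Proof.
elim/int_ind: a => [|n IH|n IH].
- by rewrite add0r; apply: isomorphic_refl.
- have -> : Posz n.+1 + b = (n%:Z + b) + 1 by lia.
  have -> : Posz n.+1 = n%:Z + 1 by lia.
  apply: isomorphic_trans (shift_succ _ _) _.
  apply: isomorphic_trans _ (isomorphic_sym (shift_succ _ _)).
  exact: isomorphic_fmap.
apply: isomorphic_shift1.
apply: isomorphic_trans (isomorphic_sym (shift_succ _ _)) _.
apply: isomorphic_trans _ (shift_succ _ _).
have -> : - Posz n.+1 + b + 1 = - n%:Z + b by lia.
by have -> : - Posz n.+1 + 1 = - n%:Z by lia.
Qed.

Lemma shiftN1_shift_succ (D : triangulated) (n : int) (X : D) :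
  isomorphic (shiftN1 (shift (n + 1) X)) (shift n X).
Proof.
apply: isomorphic_trans (isomorphic_fmap shiftN1 (shift_succ _ _)) _.
exact: shift1K_iso.
Qed.

Lemma ext_shift (D : triangulated) (n : int) (X Y Z : D) :
  ext X Y Z -> ext (shift n X) (shift n Y) (shift n Z).
Proof.
case: n => n XYZ /=.
  by elim: n => //= n IH; apply: ext_shift1.
by elim: n => /= [|n IH]; apply: ext_shiftN1.
Qed.

Lemma vanish_shift (D : triangulated) (n : int) (X Y : D) :
  vanish (shift n X) (shift n Y) -> vanish X Y.
Proof.
have vanishN (U V : D) : vanish (shiftN1 U) (shiftN1 V) -> vanish U V.
  move/vanish_shiftN1; apply: vanish_isol; exact: shiftN1K_iso.
case: n => n /=; first by elim: n => //= n IH /vanish_shift1.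
by elim: n => /= [|n IH] /vanishN.
Qed.

Lemma t_le0_shift (D : triangulated) (t : t_structure D) (a b : int) (X : D) :
  a <= b -> t_le0 t (shift a X) -> t_le0 t (shift b X).
Proof.
move=> ab; have -> : b = a + `|b - a|%N by lia.
elim: {b ab}`|b - a|%N => [|n IH] X0; first by rewrite addr0.
have -> : a + n.+1 = a + n + 1 by lia.
by apply: t_le0_iso (isomorphic_sym (shift_succ _ _)) _;
  apply: t_le0_shift1; apply: IH.
Qed.

Lemma t_ge1_shift (D : triangulated) (t : t_structure D) (a b : int) (X : D) :
  a <= b -> t_ge1 t (shift b X) -> t_ge1 t (shift a X).
Proof.
move=> ab; have -> : b = a + `|b - a|%N by lia.
elim: {b ab}`|b - a|%N => [|n IH]; first by rewrite addr0.
have -> : a + n.+1 = a + n + 1 by lia.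
by move/t_ge1_shiftN1 => X1; apply: IH; apply: t_ge1_iso (shiftN1_shift_succ _ _) X1.
Qed.

Lemma t_ge1_shift_lt0 (D : triangulated) (t : t_structure D) (a : int) (X : D) :
  a < 0 -> t_ge0 t X -> t_ge1 t (shift a X).
Proof. by move=> a0; apply: (@t_ge1_shift _ _ _ (- 1)); lia. Qed.

(** * Cohomology objects *)

(* [L] plays the role of the truncation of [X] in degrees <= 0, and [N[1]]
   that of its truncation in degrees < 0. *)
Definition cohomology (D : triangulated) (t : t_structure D) (X K : D) : Prop :=
  exists L B N : D, [/\ t_le0 t L, t_ge1 t B, t_le0 t N & t_ge0 t K] /\
    ext L X B /\ ext (shift1 N) L K.

Lemma cohomology_H0 (D : triangulated) (t : t_structure D) (X : D) :
  cohomology t X (sval (H0 t X)).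
Proof.
rewrite /= /tau_le0; case: cid => -[L B] /= [L0 B1 LXB].
rewrite /tau_ge0 /tau_ge1; case: cid => -[N K] /= [N0 K1 /ext_shift1 NLK].
exists L, B, N; split; first by split=> //; apply: t_ge0_shift1.
by split=> //; apply: ext_iso NLK; try exact: isomorphic_refl;
  apply: shiftN1K_iso.
Qed.

Lemma cohomology_iso (D : triangulated) (t : t_structure D) (X X' K K' : D) :
  isomorphic X X' -> isomorphic K K' -> cohomology t X K -> cohomology t X' K'.
Proof.
move=> XX' KK' [L [B [N [[L0 B1 N0 K0] [LXB NLK]]]]].
exists L, B, N; split; first by split=> //; apply: t_ge0_iso K0.
by split; [apply: ext_iso LXB | apply: ext_iso NLK] => //;
  apply: isomorphic_refl.
Qed.

Lemma cohomology_unique (D : triangulated) (t : t_structure D) (X K K' : D) :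
  cohomology t X K -> cohomology t X K' -> isomorphic K K'.
Proof.
move=> [L [B [N [[L0 B1 N0 K0] [LXB NLK]]]]].
move=> [L' [B' [N' [[L'0 B'1 N'0 K'0] [LXB' NLK']]]]].
have [LL' _] := ext_unique LXB LXB' (isomorphic_refl X)
  (t_vanish L0 B'1) (t_vanish L'0 B1) (t_vanish (t_le0_shift1 L0) B1)
  (t_vanish (t_le0_shift1 L'0) B'1).
by have [_] := ext_unique NLK NLK' LL' (t_vanish0 N0 K'0) (t_vanish0 N'0 K0)
  (t_vanish0 (t_le0_shift1 N0) K0) (t_vanish0 (t_le0_shift1 N'0) K'0).
Qed.

Lemma ext_zero_r (D : triangulated) (X O : D) : is_zero O -> ext X X O.
Proof. by move=> O0; exists (idm X), 0, 0; apply: TR1_id. Qed.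

Lemma cohomology_zero (D : triangulated) (t : t_structure D) (X K : D) :
  t_le0 t (shiftN1 X) -> is_zero K -> cohomology t X K.
Proof.
move=> X0 K0; have XX := shiftN1K_iso X.
exists X, K, (shiftN1 X); split; last first.
  split; first exact: ext_zero_r.
  by apply: ext_iso (ext_zero_r _ K0) => //;
    [apply: isomorphic_sym | apply: isomorphic_refl..].
have [_ K1] := t_zero t K0; split=> //; last exact: t_ge1_ge0.
exact: t_le0_iso XX (t_le0_shift1 X0).
Qed.

Lemma heart_isomorphic (D : triangulated) (t : t_structure D) (X Y : heart t) :
  @isomorphic D (sval X) (sval Y) -> isomorphic X Y.
Proof. by []. Qed.

Lemma heart_is_zero (D : triangulated) (t : t_structure D) (X : heart t) :
  is_zero X -> @is_zero D (sval X).
Proof. by move=> X0; apply: is_zeroP; apply: (proj1 (X0 X) (idm X)). Qed.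

(** Membership in [theta] can be tested on any truncation triangles at hand, not only on the chosen
    ones behind [Hk]. *)
Lemma thetaP (D : triangulated) (t : t_structure D) (C : int -> subcat (heart t))
    (X : D) :
  (forall k, additive_subcat (C k)) ->
  theta C X <-> forall k, exists K : heart t,
    C k K /\ cohomology t (shift k X) (sval K).
Proof.
move=> Cadd; split=> [CX k|CX k].
  by exists (Hk t k X); split; [apply: CX | apply: cohomology_H0].
have [K [CK HK]] := CX k; case: (Cadd k) => Ciso _ _; apply: Ciso CK.
exact/heart_isomorphic/(cohomology_unique HK)/cohomology_H0.
Qed.
(** * The aisle of an ICE sequence *)

Lemma theta_vanish (D : triangulated) (t : t_structure D)
    (C : int -> subcat (heart t)) (W V : D) :
  bounded t -> (forall k, additive_subcat (C k)) -> theta C W ->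
  (forall k (K : heart t), C k K -> vanish (sval K) (shift k V)) -> vanish W V.
Proof.
move=> [le_bd ge_bd] Cadd /(thetaP _ Cadd) CW CV.
have [b [W' [W'0 WW']]] := le_bd W.
have [a [V' [V'1 VV']]] := ge_bd V.
have Wb : t_le0 t (shift b W).
  apply: t_le0_iso W'0; apply: isomorphic_sym.
  apply: isomorphic_trans (shift_iso b WW') _.
  apply: isomorphic_trans (isomorphic_sym (shift_add _ _ _)) _.
  by rewrite subrr; apply: isomorphic_refl.
have Va : t_ge1 t (shift (a - 1) V).
  apply: t_ge1_iso V'1; apply: isomorphic_sym.
  apply: isomorphic_trans (shift_iso (a - 1) VV') _.
  apply: isomorphic_trans (isomorphic_sym (shift_add _ _ _)) _.
  by rewrite subrr; apply: isomorphic_refl.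
(* Induction from the degree where [V] lies in [t_ge1]. Quantifying over all truncation triangles of
   the shift of [W] lets the hypothesis apply to the triangle built by the octahedron. *)
have main (p : nat) (L B : D) : t_le0 t L -> t_ge1 t B ->
    ext L (shift (a - 1 + p%:Z) W) B -> vanish L (shift (a - 1 + p%:Z) V).
  elim: p L B => [|p IH] L B L0 B1; first by rewrite addr0 => _; apply: t_vanish Va.
  have -> : a - 1 + p.+1%:Z = a - 1 + p%:Z + 1 by lia.
  set j := a - 1 + p%:Z in IH *; move=> LWB.
  have [N [B' [N0 B'1 /ext_shift1 NB']]] := truncation t (shiftN1 L).
  have NB : ext (shift1 N) L (shift1 B').
    by apply: ext_iso NB'; [apply: isomorphic_refl | apply: shiftN1K_iso |
      apply: isomorphic_refl].
  have K0 := t_ge0_shift1 B'1.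
  have [K [CK HK]] := CW (j + 1).
  have KK : isomorphic (sval K) (shift1 B').
    by apply: cohomology_unique HK _; exists L, B, N.
  apply: (ext_vanishl NB _ (vanish_isol KK (CV _ _ CK))).
  (* Desuspending [shift1 N -> L -> shift (j + 1) W] gives the truncation triangle of [shift j W],
     with left term [N]. *)
  have [B2 [NWB KBB]] := octahedron_cone NB LWB.
  have B20 := t_ge0_ext KBB K0 (t_ge1_ge0 B1).
  apply: vanish_isor (isomorphic_sym (shift_succ _ _)) _; apply/vanish_shift1.
  apply: (IH N (shiftN1 B2)) => //.
  by apply: ext_iso (ext_shiftN1 NWB); [apply: shift1K_iso |
    apply: shiftN1_shift_succ | apply: isomorphic_refl].
have [[O0 O00] _] := tcat_additive D.
(* For such [p] the shift of [W] is its own truncation, with zero right term. *)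
have [p bp] : exists p : nat, b <= a - 1 + p%:Z.
  by exists `|(b - (a - 1))%R|%N; lia.
apply: (@vanish_shift _ (a - 1 + p%:Z)).
apply: (main _ _ O0); first exact: t_le0_shift Wb.
  by have [] := t_zero t O00.
exact: ext_zero_r.
Qed.

(** The bound on [A] drives the induction: it makes [A -> A' -> I'], shifted by [k + 1], a
    truncation triangle, so that [I] is the cohomology of [A'] in that degree. *)
Lemma theta_approximation (D : triangulated) (t : t_structure D)
    (C : int -> subcat (heart t)) (m : int) (p : nat) (X : D) :
  contravariantly_finite (in_heart t) -> ICE_sequence C ->
  (forall k, contravariantly_finite (C k)) -> t_ge1 t (shift m X) ->
  exists A V : D, [/\ ext A X V, theta C A, t_le0 t (shift (m + p%:Z) A)
    & forall (j : int) (K : heart t), j <= m + p%:Z -> C j K ->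
        vanish (sval K) (shift j V)].
Proof.
move=> heart_cf C_ice C_cf X1.
have Cadd k : additive_subcat (C k) by have [[]] := C_ice k.
have [[O O0] _] := tcat_additive D.
have cohomology0 j (Y : D) : t_le0 t (shiftN1 Y) ->
    exists K : heart t, C j K /\ cohomology t Y (sval K).
  move=> Y0; have [_ [K [K0 CK]] _] := Cadd j.
  by exists K; split=> //; apply: cohomology_zero => //; apply: heart_is_zero.
elim: p => [|p [A [V [AXV /(thetaP _ Cadd) CA A0 CV]]]].
  exists O, X; split.
  - apply: ext_iso (ext_rotN (ext_zero_r X O0));
      [|exact: isomorphic_refl..].
    exact: zero_isomorphic (is_zero_fmap shiftN1 O0) O0.
  - apply/(thetaP _ Cadd) => k; apply: cohomology0.
    by have [] := t_zero t (is_zero_fmap shiftN1 (is_zero_shift k O0)).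
  - by have [] := t_zero t (is_zero_shift (m + 0%:Z) O0).
  move=> j K; rewrite addr0 => jm _; apply: t_vanish (heart_le0 K) _.
  exact: t_ge1_shift X1.
set k := m + p%:Z in A0 CV.
have -> : m + p.+1%:Z = k + 1 by rewrite /k; lia.
have [Pice TP Ttors] := C_ice k; have [Tice _ _] := C_ice (k + 1).
have [I [Z [TI IVZ PZ TZ]]] : exists (I : heart t) (Z : D),
    [/\ C (k + 1) I, ext (sval I) (shift (k + 1) V) Z,
     forall K, C k K -> vanish (shift1 (sval K)) Z
     & forall K, C (k + 1) K -> vanish (sval K) Z].
  apply: approximation_step Pice Tice TP Ttors _ => // K PK.
  apply: vanish_isor (isomorphic_sym (shift_succ _ _)) _; apply/vanish_shift1.
  by apply: CV PK.
have shiftK a (Y : D) : isomorphic (shift a (shift (- a) Y)) Y.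
  apply: isomorphic_trans (isomorphic_sym (shift_add _ _ _)) _.
  by rewrite subrr; apply: isomorphic_refl.
pose I' := shift (- (k + 1)) (sval I); pose V' := shift (- (k + 1)) Z.
have IVV : ext I' V V'.
  apply: ext_iso (ext_shift (- (k + 1)) IVZ); [exact: isomorphic_refl | |
    exact: isomorphic_refl].
  by have := shiftK (- (k + 1)) V; rewrite opprK.
have I'1 j : j <= k -> t_ge1 t (shift j I').
  move=> jk; apply: t_ge1_iso (shift_add _ _ _) _.
  by apply: t_ge1_shift_lt0 (heart_ge0 I); lia.
have [A' [AXV' AAI]] := octahedron_fiber AXV IVV.
have AAk : ext (shift1 (shift k A)) (shift (k + 1) A') (sval I).
  apply: ext_iso (ext_shift (k + 1) AAI); [exact: shift_succ |
    exact: isomorphic_refl | exact: shiftK].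
have A'0 : t_le0 t (shift (k + 1) A').
  exact: t_le0_ext AAk (t_le0_shift1 A0) (heart_le0 I).
exists A', V'; split=> //; last first.
  move=> j K jk CK; have [jE|jn] := eqVneq j (k + 1).
    rewrite jE in CK *.
    exact: vanish_isor (isomorphic_sym (shiftK _ _)) (TZ _ CK).
  have [jE'|jn'] := eqVneq j k.
    rewrite jE' in CK *; apply/vanish_shift1.
    apply: vanish_isor (PZ _ CK); apply: isomorphic_trans _ (shift_succ _ _).
    exact/isomorphic_sym/shiftK.
  (* Below degree [k] the new contribution [shift1 I'], shifted by [j], still lies in [t_ge1], since
     [j + 1 <= k]. *)
  have VVI := ext_shift j (ext_rot IVV).
  apply: ext_vanishr VVI _ _; first by apply: CV CK; lia.
  apply: t_vanish (heart_le0 K) _.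
  have := I'1 (j + 1); rewrite -[shift1 _]/(shift 1 I') => I'j.
  by apply: t_ge1_iso (shift_add _ _ _) _; apply: I'j; lia.
(* Up to degree [k], [I'] only enlarges the right truncation and the cohomology of [A] persists;
   degree [k + 1] contributes [I], and beyond it the cohomology is zero. *)
apply/(thetaP _ Cadd) => j; have [jk|jk] := leP j k.
  have [K [CK [L [B [N [[L0 B1 N0 K0] [LAB NLK]]]]]]] := CA j.
  exists K; split=> //.
  have [B' [LAB' BBI]] := octahedron_cone LAB (ext_shift j AAI).
  exists L, B', N; split=> //; split=> //.
  exact: t_ge1_ext BBI B1 (I'1 _ jk).
have [->|jn] := eqVneq j (k + 1).
  exists I; split=> //; have [_ O1] := t_zero t O0.
  exists (shift (k + 1) A'), O, (shift k A).
  by do ?split=> //; [apply: heart_ge0 | apply: ext_zero_r].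
apply: cohomology0; have -> : j = j - 1 + 1 by lia.
apply: t_le0_iso (isomorphic_sym (shiftN1_shift_succ _ _)) _.
by apply: t_le0_shift A'0; lia.
Qed.

(** The sequence is decreasing, as [C (k + 1)] lies in [alpha (C k)], hence in [C k]. *)
Lemma ICE_sequence_vanish (D : triangulated) (t : t_structure D)
    (C : int -> subcat (heart t)) (n k : int) (K : heart t) :
  ICE_sequence C -> (forall X, C n X -> is_zero X) -> n <= k -> C k K ->
  is_zero K.
Proof.
move=> C_ice Cn nk; have -> : k = n + `|k - n|%N by lia.
elim: {k nk}`|k - n|%N K => [|p IH] K; first by rewrite addr0; apply: Cn.
have -> : n + p.+1 = n + p + 1 by lia.
by have [_ alC _] := C_ice (n + p); move=> /alC [/IH].
Qed.

Lemma theta_decomposition (D : triangulated) (t : t_structure D)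
    (C : int -> subcat (heart t)) (X : D) :
  bounded t -> contravariantly_finite (in_heart t) -> ICE_sequence C ->
  (forall k, contravariantly_finite (C k)) -> terminates_to_zero C ->
  exists A V : D, [/\ ext A X V, theta C A
    & forall W : D, theta C W -> vanish W V].
Proof.
move=> t_bd heart_cf C_ice C_cf [n Cn].
have [a [X' [X'1 XX']]] := proj2 t_bd X.
have X1 : t_ge1 t (shift (a - 1) X).
  apply: t_ge1_iso X'1; apply: isomorphic_sym.
  apply: isomorphic_trans (shift_iso (a - 1) XX') _.
  apply: isomorphic_trans (isomorphic_sym (shift_add _ _ _)) _.
  by rewrite subrr; apply: isomorphic_refl.
have [A [V [AXV CA _ CV]]] :=
  theta_approximation `|(n - (a - 1))%R|%N heart_cf C_ice C_cf X1.
exists A, V; split=> // W CW; apply: theta_vanish t_bd _ CW _ => [k|k K CK].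
  by have [[]] := C_ice k.
(* Whatever the sign of [n - (a - 1)], the last degree treated is at least [n], so [C k] is zero
   beyond it. *)
have [kn|kn] := leP k (a - 1 + `|(n - (a - 1))%R|%N%:Z); first exact: CV kn CK.
move=> f; have K0 : is_zero K by apply: ICE_sequence_vanish C_ice Cn _ CK; lia.
exact: (proj1 (heart_is_zero K0 _)).
Qed.

Theorem proposition5p2 (D : triangulated) (t : t_structure D)
    (t_bounded : bounded t)
    (heart_cf : contravariantly_finite (in_heart t))
    (C : int -> subcat (heart t))
    (C_ice : ICE_sequence C)
    (C_cf : forall k : int, contravariantly_finite (C k))
    (C_term : terminates_to_zero C) :
  contravariantly_finite (theta C) /\ aisle (theta C).
Proof.
have Cadd k : additive_subcat (C k) by have [[]] := C_ice k.
have decomp X := theta_decomposition X t_bounded heart_cf C_ice C_cf C_term.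
have theta_iso (X Y : D) : isomorphic X Y -> theta C X -> theta C Y.
  move=> XY /(thetaP _ Cadd) CX; apply/(thetaP _ Cadd) => k.
  have [K [CK HK]] := CX k; exists K; split=> //.
  by apply: cohomology_iso HK; [apply: shift_iso | apply: isomorphic_refl].
(* The cohomology of [shift1 X] in degree [k] is that of [X] in degree [k + 1], and the sequence is
   decreasing. *)
have theta_shift1 (X : D) : theta C X -> theta C (shift1 X).
  move=> /(thetaP _ Cadd) CX; apply/(thetaP _ Cadd) => k.
  have [K [CK HK]] := CX (k + 1); exists K; split.
    by have [_ alC _] := C_ice k; case: (alC _ CK).
  by apply: cohomology_iso HK; [apply: shift_add k 1 X | apply: isomorphic_refl].
split=> [X|].
  have [A [V [[f [g [h fgh]]] CA CV]]] := decomp X; exists A, f; split=> // B x CB.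
  exact: dist_lift1 fgh (CV _ CB _).
pose V : subcat D := fun Y => forall W : D, theta C W -> vanish W Y.
(* [theta C] is the whole left orthogonal of [V], so its additivity becomes formal. *)
have theta_perp (W : D) : (forall Y, V Y -> vanish W Y) -> theta C W.
  move=> WV; have [A [Y [AWY CA VY]]] := decomp W.
  exact: theta_iso (ext_iso1 AWY (WV _ VY) (VY _ (theta_shift1 _ CA))) CA.
exists V; split=> //.
- have sum_vanishl (X Y S Z : D) : is_direct_sum X Y S ->
      vanish X Z -> vanish Y Z -> vanish S Z.
    move=> [i1 [i2 [p1 [p2 [_ _ _ _ idS]]]]] XZ YZ f.
    by rewrite -[f]compm1 -idS compDr !compA (XZ (f \oc i1)) (YZ (f \oc i2))
      !comp0m addr0.
  have sum_vanishr (X Y S Z : D) : is_direct_sum X Y S ->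
      vanish Z X -> vanish Z Y -> vanish Z S.
    move=> [i1 [i2 [p1 [p2 [_ _ _ _ idS]]]]] XZ YZ f.
    by rewrite -[f]comp1m -idS compDl -!compA (XZ (p1 \oc f)) (YZ (p2 \oc f))
      !compm0 addr0.
  have [[O O0] _] := tcat_additive D.
  split; split=> //.
  + exists O; split=> //; apply: theta_perp => Y _ f; exact: (proj1 (O0 Y)).
  + move=> X Y S XYS CX CY; apply: theta_perp => Z VZ.
    by apply: sum_vanishl XYS _ _; apply: VZ.
  + by move=> X Y XY VX W CW; apply: vanish_isor XY (VX W CW).
  + exists O; split=> // W _ f; exact: (proj2 (O0 W)).
  + move=> X Y S XYS VX VY W CW.
    by apply: sum_vanishr XYS _ _; [apply: VX | apply: VY].
- by move=> X VX W CW; apply/vanish_shiftN1; apply/VX/theta_shift1.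
- by move=> X Y f CX VY; apply: VY.
move=> X; have [A [Y [AXY CA VY]]] := decomp X.
by exists (A, Y); split.
Qed.
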